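(* Let $A$ be a (possibly unbounded) self-adjoint operator on a complex Hilbert space $X$, and let $\{A_n\}_{n\in\mathbb{N}}$ be a sequence of (possibly unbounded) self-adjoint operators on $X$ such that the range $\mathcal{R}(A_n)$ is closed for every $n\in\mathbb{N}$. Suppose that for every $\lambda\in\mathbb{C}\setminus\mathbb{R}$ the resolvents converge strongly: $(\lambda I-A_n)^{-1}x\to(\lambda I-A)^{-1}x$ as $n\to\infty$ for all $x\in X$. Then: (a) If $\sup_n\|A_n^\dagger\|<+\infty$, then the range $\mathcal{R}(A)$ is closed. (b) The following are equivalent: (i) $\mathcal{D}(A^\dagger)=X$ and $A_n^\dagger y\to A^\dagger y$ in norm as $n\to\infty$ for every $y\in X$; (ii) $\sup_n\|A_n^\dagger\|<+\infty$.
   Context: For a linear operator $T:\mathcal{D}(T)\subseteq X\to X$ write $\mathcal{D}(T),\mathcal{R}(T),\mathcal{N}(T)$ for its domain, range and kernel. Moore-Penrose inverse: if $T$ is a closed linear operator on $X$, then $\mathcal{N}(T)$ is closed and $\mathcal{D}(T)=\mathcal{N}(T)\oplus\mathcal{C}(T)$ with $\mathcal{C}(T):=\mathcal{D}(T)\cap\mathcal{N}(T)^\perp$. The restriction $T_0:=T|_{\mathcal{C}(T)}$ is a bijection from $\mathcal{C}(T)$ onto $\mathcal{R}(T)$. The Moore-Penrose inverse $T^\dagger$ is the unique linear operator with domain $\mathcal{D}(T^\dagger)=\mathcal{R}(T)+\mathcal{R}(T)^\perp$ that equals $T_0^{-1}$ on $\mathcal{R}(T)$ and has kernel $\mathcal{N}(T^\dagger)=\mathcal{R}(T)^\perp$.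 If $\mathcal{R}(T)$ is closed, then $\mathcal{D}(T^\dagger)=X$ and $T^\dagger$ is a bounded operator on $X$; in particular each $\|A_n^\dagger\|$ is finite. *)

(* Defs.v *)
From HB Require Import structures.
From mathcomp Require Import all_boot all_order all_algebra.
From mathcomp Require Import sesquilinear complex.
From mathcomp Require Import all_classical all_reals all_analysis.

Set Implicit Arguments.
Unset Strict Implicit.
Unset Printing Implicit Defensive.

Import Order.TTheory GRing.Theory Num.Theory.
Import numFieldNormedType.Exports.

Local Open Scope classical_set_scope.
Local Open Scope ring_scope.

(* A partially defined linear operator. The underlying Rocq function is total;
   its values outside of [op_dom] carry no information and no definition below
   depends on them. *)
Record linop (K : numFieldType) (X : lmodType K) := Linop {
  op_dom : set X;
  op_fun :> X -> X;
  op_dom0 : op_dom 0;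
  op_dom_lin : forall (a : K) x y,
    op_dom x -> op_dom y -> op_dom (a *: x + y);
  op_lin : forall (a : K) x y,
    op_dom x -> op_dom y -> op_fun (a *: x + y) = a *: op_fun x + op_fun y
}.

HB.instance Definition _ (K : numFieldType) (X : lmodType K) :=
  gen_eqMixin (linop X).
HB.instance Definition _ (K : numFieldType) (X : lmodType K) :=
  gen_choiceMixin (linop X).

Section Algebra.
Context {K : numFieldType} {X : lmodType K}.
Implicit Type T : linop X.

Definition op_range T : set X := [set T x | x in op_dom T].

Definition op_ker T : set X := [set x | op_dom T x /\ T x = 0].

Definition op_graph T : set (X * X) := [set p | op_dom T p.1 /\ T p.1 = p.2].

(* (l I - T)^-1 x *)
Definition resolvent (l : K) T (x : X) : X :=
  xget 0 [set u | op_dom T u /\ l *: u - T u = x].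

Definition zero_op : linop X.
Proof.
by apply: (@Linop _ _ setT (fun=> 0)) => // a x y _ _; rewrite scaler0 addr0.
Defined.

End Algebra.

(* The norm of a normed module over [R[i]] takes its values in [R[i]]; they are
   nonnegative reals, which [complex.Re] sends to [R]. *)
Definition opnorm {R : realType} {X : normedModType R[i]} (T : linop X)
    : \bar R :=
  ereal_sup [set (complex.Re `|T x|)%:E | x in [set x | op_dom T x /\ `|x| <= 1]].

Section Hilbert.
Context {R : realType} {X : normedModType R[i]}.
Variable dot : {dot X for @Num.conj R[i]}.
Implicit Types (T S : linop X) (V : set X).

Definition orthocompl V : set X := [set x | forall v, V v -> dot x v = 0].

(* The graph of the adjoint; it is functional when [op_dom T] is dense. *)
Definition adjoint_graph T : set (X * X) :=
  [set p | forall x, op_dom T x -> dot (T x) p.1 = dot x p.2].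

Definition self_adjoint T : Prop :=
  dense (op_dom T) /\ adjoint_graph T = op_graph T.

(* C(T) *)
Definition op_carrier T : set X := op_dom T `&` orthocompl (op_ker T).

Definition is_moore_penrose T S : Prop :=
  [/\ op_dom S = [set y | exists u v,
        [/\ op_range T u, orthocompl (op_range T) v & y = u + v]],
      forall x, op_carrier T x -> S (T x) = x
    & op_ker S = orthocompl (op_range T)].

(* Whenever D(T) = N(T) + C(T), which holds for every closed T, there is such an
   operator and its domain and its values there are determined by T, see
   [moore_penroseP] and [moore_penrose_uniq]. *)
Definition moore_penrose T : linop X := xget zero_op (is_moore_penrose T).

Definition op_decomposable T : Prop := forall x, op_dom T x ->
  exists k c, [/\ op_ker T k, op_carrier T c & x = k + c].

Lemma orthocompl_lin V a x y :
  orthocompl V x -> orthocompl V y -> orthocompl V (a *: x + y).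
Proof.
by move=> Vx Vy v Vv; rewrite linearPl /= Vx// Vy// mulr0 addr0.
Qed.

Lemma orthocompl0 V : orthocompl V 0.
Proof. by move=> v Vv; rewrite linear0l. Qed.

Lemma orthocompl_self V x : V x -> orthocompl V x -> x = 0.
Proof.
move=> Vx /(_ _ Vx) xx0; apply/eqP/negP => /negP /(@neq0_dnorm_gt0 _ _ _ dot).
by rewrite xx0 ltxx.
Qed.

Lemma op_add T x y : op_dom T x -> op_dom T y ->
  op_dom T (x + y) /\ T (x + y) = T x + T y.
Proof.
move=> Tx Ty; have := op_dom_lin 1 Tx Ty; have := op_lin 1 Tx Ty.
by rewrite !scale1r.
Qed.

Lemma op_sub T x y : op_dom T x -> op_dom T y ->
  op_dom T (x - y) /\ T (x - y) = T x - T y.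
Proof.
move=> Tx Ty; have := op_dom_lin (-1) Ty Tx; have := op_lin (-1) Ty Tx.
by rewrite !scaleN1r ![- _ + _]addrC.
Qed.

Lemma moore_penroseE T S : op_decomposable T -> is_moore_penrose T S ->
  forall x v, op_carrier T x -> orthocompl (op_range T) v -> S (T x + v) = x.
Proof.
move=> TD [Sdom ST Sker] x v Cx Rv.
have Sd : op_dom S (T x).
  rewrite Sdom; exists (T x), 0; split; rewrite ?addr0//; last exact: orthocompl0.
  by exists x => //; case: Cx.
have [Sv S0] : op_ker S v by rewrite Sker.
by have [_ ->] := op_add Sd Sv; rewrite S0 addr0 ST.
Qed.

Lemma op_range_carrier T u : op_decomposable T -> op_range T u ->
  exists2 c, op_carrier T c & T c = u.
Proof.
move=> TD [x Tx <-]; have [k [c [[Tk k0] Cc ->]]] := TD _ Tx.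
by exists c => //; have [_ ->] := op_add Tk Cc.1; rewrite k0 add0r.
Qed.

Lemma moore_penrose_uniq T S S' : op_decomposable T ->
  is_moore_penrose T S -> is_moore_penrose T S' -> op_graph S = op_graph S'.
Proof.
move=> TD mS mS'; have [Sd _ _] := mS; have [Sd' _ _] := mS'.
have SS' y : op_dom S y -> S y = S' y.
  rewrite Sd => -[_ [v [/(op_range_carrier TD)[c Cc <-] Rv ->]]].
  by rewrite (moore_penroseE TD mS)// (moore_penroseE TD mS').
apply/seteqP; split => -[y z] [/= yd <-]; split => /=.
- by rewrite Sd' -Sd.
- by rewrite SS'.
- by rewrite Sd -Sd'.
- by rewrite SS'// Sd -Sd'.
Qed.

Lemma moore_penroseP T : op_decomposable T ->
  is_moore_penrose T (moore_penrose T).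
Proof.
move=> TD; suff [S mS] : exists S, is_moore_penrose T S by exact: xgetI mS.
pose D := [set y | exists u v,
  [/\ op_range T u, orthocompl (op_range T) v & y = u + v]].
pose P y := [set c | op_carrier T c /\ orthocompl (op_range T) (y - T c)].
have PD y : D y -> exists c, P y c.
  move=> [_ [v [/(op_range_carrier TD)[c Cc <-] Rv ->]]].
  by exists c; split => //; rewrite addrC addKr.
have carrier_lin a c d : op_carrier T c -> op_carrier T d ->
    op_carrier T (a *: c + d).
  by move=> [Tc Nc] [Td Nd]; split; [exact: op_dom_lin|exact: orthocompl_lin].
have P_lin a y z c d : P y c -> P z d -> P (a *: y + z) (a *: c + d).
  move=> [Cc Rc] [Cd Rd]; split; first exact: carrier_lin.
  rewrite op_lin; [|exact: Cc.1|exact: Cd.1].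
  by rewrite opprD addrACA -scalerBr; exact: orthocompl_lin.
have P_uniq y c d : P y c -> P y d -> c = d.
  move=> Pc Pd; have := P_lin (-1) _ _ _ _ Pd Pc.
  rewrite !scaleN1r addNr addrC => -[[Tcd Ncd]]; rewrite sub0r => Rcd.
  have Tcd0 : T (c - d) = 0.
    apply/oppr_inj; rewrite oppr0; apply: orthocompl_self Rcd.
    exists (- (c - d)); first by rewrite -[- _]addr0 -scaleN1r;
      apply: op_dom_lin => //; exact: op_dom0.
    by have [_] := op_sub (op_dom0 T) Tcd; rewrite sub0r => ->;
      have [_] := op_sub (op_dom0 T) (op_dom0 T); rewrite !subrr => ->;
      rewrite sub0r.
  by apply/eqP; rewrite -subr_eq0; apply/eqP; exact: orthocompl_self Ncd.
pose f y := xget 0 (P y).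
have fP y : D y -> P y (f y) by move=> /PD[c Pc]; exact: xgetI Pc.
have fE y c : P y c -> f y = c.
  by move=> Pc; apply: (P_uniq y) => //; exact: xgetI Pc.
have DP y c : P y c -> D y.
  move=> [Cc Rc]; exists (T c), (y - T c); split; rewrite ?subrKC//.
  by exists c => //; case: Cc.
have carrier0 : op_carrier T 0 by split; [exact: op_dom0|exact: orthocompl0].
have T0 : T 0 = 0 by have [_] := op_sub (op_dom0 T) (op_dom0 T); rewrite !subrr.
have P0 v : orthocompl (op_range T) v -> P v 0.
  by move=> Rv; split => //; rewrite T0 subr0.
have D0 : D 0 by apply: DP (P0 _ (@orthocompl0 _)).
have Dlin a y z : D y -> D z -> D (a *: y + z).
  by move=> /fP Dy /fP Dz; apply: DP (P_lin _ _ _ _ _ Dy Dz).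
have flin a y z : D y -> D z -> f (a *: y + z) = a *: f y + f z.
  by move=> /fP Dy /fP Dz; apply: fE; exact: P_lin.
exists (Linop D0 Dlin flin); split => //=.
  by move=> x Cx; apply: fE; split => //; rewrite subrr; exact: orthocompl0.
apply/seteqP; split => [y [/fP[_ +] /= fy0]|y Ry].
  by rewrite fy0 T0 subr0.
by split => /=; [exact: DP (P0 _ Ry)|exact: fE (P0 _ Ry)].
Qed.

End Hilbert.

(* Main.v *)
Require Import Defs.
From mathcomp Require Import all_boot all_order all_algebra.
From mathcomp Require Import sesquilinear complex.
From mathcomp Require Import all_classical all_reals all_analysis.
From mathcomp Require Import ring lra.

Import Order.TTheory GRing.Theory Num.Theory.
Import numFieldNormedType.Exports.

Local Open Scope classical_set_scope.
Local Open Scope ring_scope.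

(** Write [N(T)], [R(T)], [C(T)] for the kernel, range and carrier of [T].
    Resolvent convergence at the single point [i] makes every [x] in [D(A)] a
    limit together with its image [A x]: [u_n = (i - A_n)^-1 (i - A) x] satisfies
    [u_n --> x] and [A_n u_n = A x + i (u_n - x) --> A x] ([graph_approx]).

    The component [k_n] of [u_n] in [N(A_n)] vanishes in the limit as soon as
    [x] is orthogonal to [N(A)] ([ker_component_cvg0]). For then [x] is a limit
    of vectors [A z], such a vector is the limit of some [A_n w_n], which is
    orthogonal to [k_n], and [|k_n|^2 = <k_n, u_n>] is therefore small compared
    with [|k_n|]. Hence each [x] in [C(A)] is approximated, with its image, by
    vectors of [C(A_n)] ([carrier_approx]).

    A bound [|A_n^dag| <= c] says that [|x| <= c |A_n x|] on [C(A_n)]. It passes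
    to the limit as [|x| <= c |A x|] on [C(A)] ([carrier_bound]), and as [A] is
    closed, this makes [R(A)] closed ([closed_range_limit]). Then every [y] is
    [A x + v] with [x] in [C(A)] and [v] in [N(A) = R(A)^perp]. Approximating
    [x] by [u_n] in [C(A_n)] and [v] by some [w_n], the vector [A_n^dag y]
    differs from [A_n^dag (A_n u_n) = u_n] by errors that tend to zero under the
    uniform bound ([moore_penrose_cvg]).

    Conversely, the operators [A_n^dag] are symmetric, so pointwise convergence
    makes the set of all [A_n^dag x] with [|x| <= 1] weakly bounded:
    [|<A_n^dag x, y>| <= |A_n^dag y|]. A weakly bounded set is bounded
    ([weakly_bounded_bounded]), which is the uniform bound on the norms.

    The Hilbert space facts behind this are the [projection] onto the closure of
    a subspace and, derived from it, the surjectivity of [i - T] for a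
    self-adjoint [T] ([sub_i_surj]). *)

Set Implicit Arguments.
Unset Strict Implicit.
Unset Printing Implicit Defensive.

(** * Real-valued norm *)

(** The norm of a module over [R[i]] is an element of [R[i]], where the order is
    partial; its real part lets estimates take place in the totally ordered
    field [R]. *)
Definition nrm {R : realType} {V : normedZmodType R[i]} (x : V) : R :=
  complex.Re `|x|.

Section RealNorm.
Context {R : realType}.
Implicit Types V : normedZmodType R[i].

Lemma nrmE V (x : V) : `|x| = ((nrm x)%:C)%C.
Proof. by rewrite /nrm RRe_real// normr_real. Qed.

Lemma nrm_ge0 V (x : V) : 0 <= nrm x.
Proof. by rewrite -lecR -nrmE normr_ge0. Qed.

Lemma nrm0 V : nrm (0 : V) = 0.
Proof. by rewrite /nrm normr0. Qed.

Lemma nrm_eq0 V (x : V) : nrm x = 0 -> x = 0.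
Proof. by move=> x0; apply/eqP; rewrite -normr_eq0 nrmE x0. Qed.

Lemma nrm_gt0 V (x : V) : x != 0 -> 0 < nrm x.
Proof.
move=> x0; rewrite lt_neqAle nrm_ge0 eq_sym andbT.
by apply: contraNneq x0 => /nrm_eq0 ->.
Qed.

Lemma nrmN V (x : V) : nrm (- x) = nrm x.
Proof. by rewrite /nrm normrN. Qed.

Lemma nrm_distC V (x y : V) : nrm (x - y) = nrm (y - x).
Proof. by rewrite -nrmN opprB. Qed.

Lemma nrmD V (x y : V) : nrm (x + y) <= nrm x + nrm y.
Proof. by rewrite -lecR rmorphD /= -!nrmE ler_normD. Qed.

Lemma nrmB V (x y : V) : nrm (x - y) <= nrm x + nrm y.
Proof. by rewrite -(nrmN y) nrmD. Qed.

Lemma nrm_distD V (z x y : V) : nrm (x - y) <= nrm (x - z) + nrm (z - y).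
Proof. by rewrite -{1}(subrK z x) -addrA nrmD. Qed.

Lemma nrmM (a b : R[i]) : nrm (a * b) = nrm a * nrm b.
Proof. by apply: (@complexI R); rewrite rmorphM /= -!nrmE normrM. Qed.

Lemma nrmMn V (x : V) n : nrm (x *+ n) = nrm x *+ n.
Proof.
by apply: (@complexI R); rewrite (rmorphMn (real_complex R)) /= -!nrmE normrMn.
Qed.

Lemma nrm_real (r : R) : nrm (r%:C%C : R[i]) = `|r|.
Proof. by rewrite /nrm normc_def /= expr0n /= addr0 sqrtr_sqr. Qed.

Lemma nrm_i : nrm ('i%C : R[i]) = 1.
Proof. by rewrite /nrm normc_def /= expr0n expr1n add0r sqrtr1. Qed.

Lemma nrmZ (V : normedModType R[i]) (a : R[i]) (x : V) :
  nrm (a *: x) = nrm a * nrm x.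
Proof. by apply: (@complexI R); rewrite rmorphM /= -!nrmE normrZ. Qed.

Lemma nrm_small V (x : V) : (forall e : R, 0 < e -> nrm x <= e) -> x = 0.
Proof.
move=> xe; apply: nrm_eq0; apply/eqP; rewrite eq_le nrm_ge0 andbT.
by apply/ler_addgt0Pl => e /xe; rewrite addr0.
Qed.

Lemma cvg_nrmP (V : normedModType R[i]) (u : nat -> V) (x : V) :
  (u n @[n --> \oo] --> x) <-> (nrm (x - u n) @[n --> \oo] --> (0 : R)).
Proof.
split=> [/cvgrPdist_lt ux|/cvgrPdist_lt ux].
  apply/cvgrPdist_lt => e e0; have eC : 0 < (e%:C)%C by rewrite ltcR.
  near=> n; rewrite sub0r normrN ger0_norm ?nrm_ge0// -ltcR -nrmE.
  by near: n; exact: ux.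
apply/cvgrPdist_lt => e e0.
have eE : e = ((complex.Re e)%:C)%C by rewrite RRe_real// gtr0_real.
rewrite eE; near=> n; rewrite nrmE ltcR.
have : `|0 - nrm (x - u n)| < complex.Re e.
  by near: n; apply: ux; rewrite -ltcR -eE.
by rewrite sub0r normrN ger0_norm ?nrm_ge0.
Unshelve. all: by end_near. Qed.

Lemma closure_nrmP (V : normedModType R[i]) (A : set V) (x : V) :
  closure A x <-> forall e : R, 0 < e -> exists2 y, A y & nrm (x - y) < e.
Proof.
split=> [clx e e0|Ae B].
  have eC : 0 < (e%:C)%C by rewrite ltcR.
  have [y [Ay]] := clx _ (nbhsx_ballx x _ eC).
  by rewrite -ball_normE /= nrmE ltcR; exists y.
move=> /nbhs_ballP[e /= e0 xB].
have eE : e = ((complex.Re e)%:C)%C by rewrite RRe_real// gtr0_real.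
have [|y Ay xy] := Ae (complex.Re e); first by rewrite -ltcR -eE.
exists y; split=> //; apply: xB.
by rewrite -ball_normE /= nrmE eE ltcR.
Qed.

(** Completeness with a rate: the limit inherits the bound on the tails, which is
    what each of the sequences constructed below needs. *)
Lemma cauchy_nrm (V : completeNormedModType R[i]) (u : nat -> V) (b : nat -> R) :
  b n @[n --> \oo] --> (0 : R) ->
  (forall n m, (n <= m)%N -> nrm (u n - u m) <= b n) ->
  exists l, forall n, nrm (l - u n) <= b n.
Proof.
move=> b0 ub.
have /cauchy_cvgP/cvg_ex[l /cvg_nrmP ul] : cauchy (u n @[n --> \oo]).
  apply: cauchy_exP => e e0.
  have eE : e = ((complex.Re e)%:C)%C by rewrite RRe_real// gtr0_real.
  have e0' : 0 < complex.Re e by rewrite -ltcR -eE.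
  have /cvgrPdist_lt/(_ _ e0')[N _ bN] := b0.
  exists (u N), N => // m /= Nm.
  rewrite -ball_normE /= nrmE eE ltcR (le_lt_trans (ub _ _ Nm))//.
  rewrite (le_lt_trans (ler_norm _))//.
  by have := bN N (leqnn N); rewrite /= sub0r normrN.
exists l => n; apply/ler_addgt0Pr => e e0.
have /cvgrPdist_lt/(_ _ e0)[N _ bN] := ul.
have := bN _ (leq_maxl N n); rewrite /= sub0r normrN ger0_norm ?nrm_ge0// => le.
rewrite (le_trans (nrm_distD (u (maxn N n)) _ _))// [b n + e]addrC.
by rewrite lerD ?(ltW le)// nrm_distC ub// leq_maxr.
Qed.

Lemma cvg_harmonicMr (k : R) : n.+1%:R^-1 * k @[n --> \oo] --> (0 : R).
Proof.
rewrite -[X in _ --> X](mul0r k); apply: cvgM; last exact: cvg_cst.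
exact: cvg_harmonic.
Qed.

End RealNorm.

(** * Inner product and orthogonal projection *)

Definition subspace {K : numFieldType} {X : lmodType K} (V : set X) :=
  V 0 /\ forall a x y, V x -> V y -> V (a *: x + y).

Section InnerProduct.
Context {R : realType} {X : normedModType R[i]}.
Variable dot : {dot X for @Num.conj R[i]}.
Hypothesis norm_dot : forall x : X, `|x| ^+ 2 = dot x x.
Implicit Types (x y z w : X) (V : set X).

Lemma dotC x y : dot x y = ((dot y x)^*)%R.
Proof. by rewrite (hermC dot x y) expr0 mul1r. Qed.

Lemma nrm_dotC x y : nrm (dot x y) = nrm (dot y x).
Proof. by rewrite dotC /nrm norm_conjC. Qed.

Lemma dot_nrm x : dot x x = ((nrm x ^+ 2)%:C)%C.
Proof. by rewrite -norm_dot nrmE rmorphXn. Qed.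

Lemma nrm_dotxx x : nrm (dot x x) = nrm x ^+ 2.
Proof. by rewrite dot_nrm nrm_real ger0_norm// sqr_ge0. Qed.

(** Pythagoras for the component of [x] along [y]. That the right-hand side is
    nonnegative is the Cauchy-Schwarz inequality; that the left-hand side is not
    below a minimal distance gives orthogonality of near-minimizers. *)
Lemma nrm_sqr_sub_proj x y : y != 0 ->
  nrm (x - (dot x y / dot y y) *: y) ^+ 2 =
  nrm x ^+ 2 - nrm (dot x y) ^+ 2 / nrm y ^+ 2.
Proof.
move=> y0; apply: (@complexI R).
have yy0 : dot y y != 0 by rewrite dnorm_eq0.
have yyC : (dot y y)^* = dot y y by rewrite -dotC.
rewrite -[LHS]dot_nrm dnormB dnormZ linearZr_LR /= (rmorphB (real_complex R)).
rewrite (rmorphM (real_complex R) (nrm (dot x y) ^+ 2)) (fmorphV (real_complex R)) /=.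
rewrite -!dot_nrm.
rewrite (rmorphXn (real_complex R)) /= -nrmE !normCK.
rewrite !(rmorphM, fmorphV) /= conjCK !yyC.
by field.
Qed.

Lemma cauchy_schwarz x y : nrm (dot x y) <= nrm x * nrm y.
Proof.
have [->|y0] := eqVneq y 0; first by rewrite linear0r !nrm0 mulr0.
have ny := nrm_gt0 y0.
rewrite -(@ler_pXn2r _ 2) ?nnegrE ?mulr_ge0 ?nrm_ge0// exprMn.
rewrite -ler_pdivrMr ?exprn_gt0// -subr_ge0 -nrm_sqr_sub_proj//.
by rewrite sqr_ge0.
Qed.

Lemma dot_eq0_of_small x y (c : R) :
  (forall e : R, 0 < e -> nrm (dot x y) <= e * c) -> dot x y = 0.
Proof.
move=> xyc; apply: nrm_small => e e0.
have c0 : 0 < `|c| + 1 by rewrite ltr_wpDl.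
rewrite (le_trans (xyc (e / (`|c| + 1)) _)) ?divr_gt0//.
by rewrite mulrAC ler_pdivrMr// ler_pM2l// (le_trans (ler_norm _))// lerDl.
Qed.

Lemma orthocompl_closure V x :
  closure (orthocompl dot V) x -> orthocompl dot V x.
Proof.
move=> /closure_nrmP xV v Vv; apply: (@dot_eq0_of_small _ _ (nrm v)) => e e0.
have [y Vy xy] := xV e e0.
have -> : dot x v = dot (x - y) v by rewrite linearBl /= Vy// subr0.
by rewrite (le_trans (cauchy_schwarz _ _))// ler_wpM2r ?nrm_ge0// ltW.
Qed.

End InnerProduct.

Section Projection.
Context {R : realType} {X : completeNormedModType R[i]}.
Variable dot : {dot X for @Num.conj R[i]}.
Hypothesis norm_dot : forall x : X, `|x| ^+ 2 = dot x x.

(** If [v] minimizes the squared distance from [x] to [V] up to [e ^ 2], then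
    moving [v] along [w] by the component of [x - v] cannot gain more than
    [e ^ 2], and this gain is [|<x - v, w>|^2 / |w|^2]. *)
Lemma near_minimizer_orthogonal (V : set X) (x v w : X) (d e : R) :
  subspace V -> (forall u, V u -> d <= nrm (x - u) ^+ 2) ->
  0 <= e -> V v -> nrm (x - v) ^+ 2 <= d + e ^+ 2 -> V w ->
  nrm (dot (x - v) w) <= e * nrm w.
Proof.
move=> [_ Vlin] dV e0 Vv xv Vw.
have [->|w0] := eqVneq w 0; first by rewrite linear0r !nrm0 mulr0.
have nw := nrm_gt0 w0.
rewrite -(@ler_pXn2r _ 2) ?nnegrE ?mulr_ge0 ?nrm_ge0// exprMn.
rewrite -ler_pdivrMr ?exprn_gt0// -(lerD2l d).
have := dV _ (Vlin (dot (x - v) w / dot w w) _ _ Vw Vv).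
rewrite [_ *: w + v]addrC opprD addrA nrm_sqr_sub_proj// => dle.
by lra.
Qed.

(** Near-minimizers [v n] of the distance are nearly orthogonal to [V]. Testing
    this with [w = v n - v m] shows that they form a Cauchy sequence, and in the
    limit the orthogonality becomes exact. *)
Lemma projection (V : set X) (x : X) : subspace V ->
  exists2 p, closure V p & orthocompl dot V (x - p).
Proof.
move=> sV; have [V0 Vlin] := sV.
pose D := [set nrm (x - v) ^+ 2 | v in V].
have D0 : has_inf D.
  split; first by exists (nrm (x - 0) ^+ 2), 0.
  by exists 0 => _ [v _ <-]; rewrite sqr_ge0.
have dV u : V u -> inf D <= nrm (x - u) ^+ 2.
  by move=> Vu; apply: ge_inf; [exact: D0.2|exists u].
pose h n : R := n.+1%:R^-1.
have h0 n : 0 < h n by rewrite invr_gt0.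
have near_min n : exists v, V v /\ nrm (x - v) ^+ 2 <= inf D + h n ^+ 2.
  have [_ [u Vu <-] le] := inf_adherent (exprn_gt0 2 (h0 n)) D0.
  by exists u; split => //; exact: ltW.
have [v vP] := choice near_min.
have orth n w : V w -> nrm (dot (x - v n) w) <= h n * nrm w.
  by move=> Vw; have [Vv vn] := vP n;
    apply: (near_minimizer_orthogonal sV dV (ltW (h0 n)) Vv vn).
have hcvg (k : R) : h n * k @[n --> \oo] --> (0 : R) by exact: cvg_harmonicMr.
have [p pv] : exists p, forall n, nrm (p - v n) <= h n * 2.
  apply: (cauchy_nrm (hcvg 2)) => n m nm.
  have hm : h m <= h n by rewrite lef_pV2 ?posrE// ler_nat.
  set w := v n - v m.
  have Vw : V w.
    by rewrite /w addrC -scaleN1r; apply: Vlin; [have [] := vP m|have [] := vP n].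
  have wE : dot w w = dot (x - v m) w - dot (x - v n) w.
    by rewrite -linearBl opprB [x - v m + _]addrC addrA subrK.
  have : nrm w ^+ 2 <= h n * 2 * nrm w.
    rewrite -(nrm_dotxx norm_dot) wE (le_trans (nrmB _ _))//.
    have := orth n w Vw; have := orth m w Vw; have := nrm_ge0 w.
    by nra.
  have [->|w0] := eqVneq (nrm w) 0; first by rewrite mulr_ge0// ltW.
  by rewrite expr2 ler_pM2r// lt_neqAle eq_sym w0 nrm_ge0.
exists p.
  apply/closure_nrmP => e e0.
  have /cvgrPdist_lt/(_ _ e0)[N _ /(_ N (leqnn N))] := hcvg 2.
  rewrite /= sub0r normrN ger0_norm ?mulr_ge0 ?(ltW (h0 _))// => le.
  by exists (v N); [have [] := vP N|exact: le_lt_trans le].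
move=> w Vw; apply: nrm_small => e e0.
have /cvgrPdist_lt/(_ _ e0)[N _ /(_ N (leqnn N))] := hcvg (3 * nrm w).
rewrite /= sub0r normrN => /(le_lt_trans (ler_norm _))/ltW; apply: le_trans.
have -> : x - p = (x - v N) - (p - v N) by rewrite opprB addrA subrK.
rewrite linearBl /= (le_trans (nrmB _ _))//.
have := cauchy_schwarz norm_dot (p - v N) w.
by have := orth N w Vw; have := pv N; have := nrm_ge0 w; nra.
Qed.

End Projection.

(** * Images of maps that are bounded below *)

Section ClosedImage.
Context {R : realType} {X : completeNormedModType R[i]}.

(** Preimages of a convergent sequence of values form a Cauchy sequence, so a
    limit [y] of values is approached along the graph of [f]. What follows from
    this about [y] is left to [S], since for an operator restricted to its
    carrier it is simpler to conclude that [y] is in the range of the whole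
    operator. *)
Lemma closure_image_bounded_below (D S : set X) (f : X -> X) (c : R) :
  (forall u v, D u -> D v -> nrm (u - v) <= c * nrm (f u - f v)) ->
  (forall x y, (forall e : R, 0 < e ->
     exists u, [/\ D u, nrm (x - u) < e & nrm (y - f u) < e]) -> S y) ->
  closure (f @` D) `<=` S.
Proof.
move=> Dc DS y /closure_nrmP yD.
pose h n : R := n.+1%:R^-1.
have h0 n : 0 < h n by rewrite invr_gt0.
have near_preimage n : exists u, D u /\ nrm (y - f u) < h n.
  by have [_ [u Du <-] yu] := yD _ (h0 n); exists u.
have [u uP] := choice near_preimage.
have hcvg (k : R) : h n * k @[n --> \oo] --> (0 : R) by exact: cvg_harmonicMr.
have [x xu] : exists x, forall n, nrm (x - u n) <= h n * (2 * `|c|).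
  apply: (cauchy_nrm (hcvg _)) => n m nm.
  have [Dn yn] := uP n; have [Dm ym] := uP m.
  have hm : h m <= h n by rewrite lef_pV2 ?posrE// ler_nat.
  have fnm := nrm_distD y (f (u n)) (f (u m)).
  rewrite (le_trans (Dc _ _ Dn Dm))// (le_trans (ler_wpM2r (nrm_ge0 _) (ler_norm c)))//.
  rewrite mulrA [leRHS]mulrC ler_wpM2l// (le_trans fnm)// nrm_distC.
  by lra.
apply: (DS x) => e e0.
have /cvgrPdist_lt/(_ _ e0)[N _ hN] := hcvg (2 * `|c|).
have /cvgrPdist_lt/(_ _ e0)[M _ hM] := hcvg 1.
have := hN (maxn N M) (leq_maxl _ _); have := hM (maxn N M) (leq_maxr _ _).
rewrite /= !sub0r !normrN mulr1 => /(le_lt_trans (ler_norm _)) le1.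
move=> /(le_lt_trans (ler_norm _)) le2.
exists (u (maxn N M)); have [Du yu] := uP (maxn N M).
by split => //; [exact: le_lt_trans le2|exact: lt_trans le1].
Qed.

End ClosedImage.

(** * Self-adjoint operators *)

Section LinearOperators.
Context {R : realType} {X : normedModType R[i]}.
Variable T : linop X.

Lemma op0 : T 0 = 0.
Proof.
have := op_lin (-1) (op_dom0 T) (op_dom0 T).
by rewrite !scaleN1r oppr0 addr0 addNr.
Qed.

Lemma subspace_range : subspace (op_range T).
Proof.
split=> [|a _ _ [x Tx <-] [y Ty <-]].
  by exists 0; [exact: op_dom0|exact: op0].
by exists (a *: x + y); [exact: op_dom_lin|exact: op_lin].
Qed.

Lemma subspace_ker : subspace (op_ker T).
Proof.
split=> [|a x y [Tx x0] [Ty y0]]; first by split; [exact: op_dom0|exact: op0].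
by split; [exact: op_dom_lin|rewrite op_lin// x0 y0 scaler0 addr0].
Qed.

End LinearOperators.

Section SelfAdjoint.
Context {R : realType} {X : completeNormedModType R[i]}.
Variable dot : {dot X for @Num.conj R[i]}.
Hypothesis norm_dot : forall x : X, `|x| ^+ 2 = dot x x.
Variable T : linop X.
Hypothesis sadjT : self_adjoint dot T.

Lemma self_adjoint_sym x y : op_dom T x -> op_dom T y ->
  dot (T x) y = dot x (T y).
Proof.
move=> Tx Ty; have [_ TT] := sadjT.
have : op_graph T (y, T y) by [].
by rewrite -TT; exact.
Qed.

Lemma self_adjoint_dom y z : (forall x, op_dom T x -> dot (T x) y = dot x z) ->
  op_dom T y /\ T y = z.
Proof.
by move=> yz; have [_ TT] := sadjT; rewrite -[_ /\ _]/(op_graph T (y, z)) -TT.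
Qed.

(** The defining relation of the adjoint is preserved under limits in the graph,
    by Cauchy-Schwarz. *)
Lemma self_adjoint_closed x y :
  (forall e : R, 0 < e ->
    exists u, [/\ op_dom T u, nrm (x - u) < e & nrm (y - T u) < e]) ->
  op_dom T x /\ T x = y.
Proof.
move=> xy; apply: self_adjoint_dom => w Tw; apply/eqP; rewrite -subr_eq0; apply/eqP.
apply: nrm_small => e e0.
pose k := nrm (T w) + nrm w + 1.
have k0 : 0 < k by rewrite ltr_wpDl// addr_ge0 ?nrm_ge0.
have [u [Tu xu yu]] := xy (e / k) (divr_gt0 e0 k0).
have -> : dot (T w) x - dot w y = dot (T w) (x - u) - dot w (y - T u).
  by rewrite !linearBr /= (self_adjoint_sym Tw Tu) opprB addrA subrK.
rewrite (le_trans (nrmB _ _))//.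
have := cauchy_schwarz norm_dot (T w) (x - u).
have := cauchy_schwarz norm_dot w (y - T u).
have ek : e / k * k = e by rewrite divfK ?gt_eqF.
have d0 : 0 < e / k by rewrite divr_gt0.
have := ler_wpM2l (nrm_ge0 (T w)) (ltW xu).
have := ler_wpM2l (nrm_ge0 w) (ltW yu).
by move: (e / k) d0 ek => d d0; rewrite /k; lra.
Qed.

Lemma orthocompl_range : orthocompl dot (op_range T) = op_ker T.
Proof.
apply/seteqP; split=> [y yR|y [Ty y0] _ [x Tx <-]].
  apply: self_adjoint_dom => x Tx; rewrite linear0r dotC yR ?rmorph0//.
  by exists x.
by rewrite -self_adjoint_sym// y0 linear0l.
Qed.

Lemma closure_ker x : closure (op_ker T) x -> op_ker T x.
Proof. by rewrite -orthocompl_range; exact: orthocompl_closure. Qed.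

Lemma self_adjoint_decomposable : op_decomposable dot T.
Proof.
move=> x Tx; have [p /closure_ker Kp xp] := projection norm_dot x (subspace_ker T).
exists p, (x - p); split; rewrite ?subrKC//.
by split => //; have [] := op_sub Tx Kp.1.
Qed.

(** [x - p], for [p] the projection of [x] on the closure of the range, is
    orthogonal to the range, hence in the kernel. But [x] and [p] are both
    orthogonal to the kernel, so that [x - p] is orthogonal to itself. *)
Lemma orthocompl_ker x : orthocompl dot (op_ker T) x -> closure (op_range T) x.
Proof.
move=> xK; have [p Rp] := projection norm_dot x (subspace_range T).
rewrite orthocompl_range => xp.
suff : x - p = 0 by move/eqP; rewrite subr_eq0 => /eqP ->.
apply: (orthocompl_self xp).
rewrite addrC -scaleN1r; apply: orthocompl_lin _ xK.
apply: (orthocompl_closure norm_dot); move: Rp; apply: closure_subset => r Rr k.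
by rewrite -orthocompl_range => /(_ _ Rr) kr; rewrite dotC kr rmorph0.
Qed.

(** The cross terms [<i x, T x>] and [<T x, i x>] cancel because [<T x, x>] is
    real. *)
Lemma nrm_sub_i x : op_dom T x ->
  nrm ('i%C *: x - T x) ^+ 2 = nrm x ^+ 2 + nrm (T x) ^+ 2.
Proof.
move=> Tx; apply: (@complexI R); rewrite -[LHS](dot_nrm norm_dot).
rewrite (rmorphD (real_complex R)) /= -!(dot_nrm norm_dot).
rewrite dnormB dnormZ linearZl_LR /= -(self_adjoint_sym Tx Tx).
have ci : ('i%C : R[i])^* = - 'i%C by rewrite complexiE conjCi.
have ss : (dot (T x) x)^* = dot (T x) x by rewrite -dotC -self_adjoint_sym.
rewrite rmorphM /= ci ss normCK ci mulrN -expr2 sqr_i opprK mul1r.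
by rewrite mulNr subrr subr0.
Qed.

Lemma op_sub_i_lin a u v : op_dom T u -> op_dom T v ->
  'i%C *: (a *: u + v) - T (a *: u + v) =
  a *: ('i%C *: u - T u) + ('i%C *: v - T v).
Proof.
move=> Tu Tv; rewrite op_lin// scalerDr scalerA mulrC -scalerA opprD addrACA.
by rewrite -scalerBr.
Qed.

Lemma sub_i_expansive u v : op_dom T u -> op_dom T v ->
  nrm (u - v) <= nrm (('i%C *: u - T u) - ('i%C *: v - T v)).
Proof.
move=> Tu Tv; have [Tuv _] := op_sub Tu Tv.
have -> : ('i%C *: u - T u) - ('i%C *: v - T v) = 'i%C *: (u - v) - T (u - v).
  by rewrite [u - v]addrC -[- v]scaleN1r op_sub_i_lin// scaleN1r addrC.
rewrite -(@ler_pXn2r _ 2) ?nnegrE ?nrm_ge0// nrm_sub_i//.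
by rewrite lerDl sqr_ge0.
Qed.

(** The range of [i - T] is closed because [i - T] is expansive and [T] closed. A
    vector [q] orthogonal to it satisfies [T q = - i q] by self-adjointness;
    then [(i - T) q = 2 i q], so [q] itself is in that range and is zero. *)
Lemma sub_i_surj y : exists2 u, op_dom T u & 'i%C *: u - T u = y.
Proof.
pose f u := 'i%C *: u - T u.
have f_cl : closure (f @` op_dom T) `<=` f @` op_dom T.
  apply: (@closure_image_bounded_below _ _ _ _ _ 1) => [u v Tu Tv|x z xz].
    by rewrite mul1r; exact: sub_i_expansive.
  have [Tx xE] : op_dom T x /\ T x = 'i%C *: x - z.
    apply: self_adjoint_closed => e e0.
    have [u [Tu xu zu]] := xz (e / 2) (divr_gt0 e0 (ltr0n _ 2)).
    exists u; split => //; first by lra.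
    have -> : 'i%C *: x - z - T u = 'i%C *: (x - u) - (z - f u).
      by rewrite /f scalerBr opprB !addrA subrK addrAC.
    rewrite (le_lt_trans (nrmB _ _))// nrmZ nrm_i mul1r.
    by lra.
  by exists x => //; rewrite /f xE opprB subrKC.
have [|p /f_cl[u Tu <-] yu] := @projection _ _ _ norm_dot (f @` op_dom T) y.
  split=> [|a _ _ [u Tu <-] [v Tv <-]].
    by exists 0; [exact: op_dom0|rewrite /f scaler0 (op0 T) subrr].
  by exists (a *: u + v); [exact: op_dom_lin|rewrite /f op_sub_i_lin].
exists u => //; apply/esym/eqP; rewrite -subr_eq0; apply/eqP.
set q := y - f u in yu *.
have [Tq qE] : op_dom T q /\ T q = - ('i%C *: q).
  apply: self_adjoint_dom => x Tx.
  have : dot (f x) q = 0 by rewrite dotC yu ?rmorph0//; exists x.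
  rewrite /f linearBl /= => /eqP; rewrite subr_eq0 => /eqP <-.
  by rewrite linearZl_LR -scaleNr linearZr_LR /= rmorphN /= complexiE conjCi opprK.
apply: (orthocompl_self _ yu).
exists (('i%C *+ 2)^-1 *: q).
  by rewrite -[_ *: q]addr0; apply: op_dom_lin => //; exact: op_dom0.
rewrite -[_ *: q]addr0 /f op_sub_i_lin//; last exact: op_dom0.
rewrite scaler0 (op0 T) subr0 addr0 qE opprK -scalerDl scalerA -mulr2n.
by rewrite mulVf ?scale1r// mulrn_eq0 complexiE neq0Ci.
Qed.

Lemma resolvent_iP y : op_dom T (resolvent 'i%C T y) /\
  'i%C *: resolvent 'i%C T y - T (resolvent 'i%C T y) = y.
Proof.
have [u Tu uy] := sub_i_surj y.
exact: (@xgetI _ 0 [set v | op_dom T v /\ 'i%C *: v - T v = y] u).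
Qed.

Lemma resolvent_iK x : op_dom T x -> resolvent 'i%C T ('i%C *: x - T x) = x.
Proof.
move=> Tx; have [Tr rE] := resolvent_iP ('i%C *: x - T x).
apply/eqP; rewrite -subr_eq0; apply/eqP/nrm_eq0/eqP; rewrite eq_le nrm_ge0 andbT.
by rewrite (le_trans (sub_i_expansive Tr Tx))// rE subrr nrm0.
Qed.

End SelfAdjoint.

(** * Moore-Penrose inverse of a self-adjoint operator *)

Section MoorePenrose.
Context {R : realType} {X : completeNormedModType R[i]}.
Variable dot : {dot X for @Num.conj R[i]}.
Hypothesis norm_dot : forall x : X, `|x| ^+ 2 = dot x x.
Variable T : linop X.
Hypothesis sadjT : self_adjoint dot T.

Local Notation Tdag := (moore_penrose dot T).

Lemma moore_penrose_decomp x v :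
  op_carrier dot T x -> op_ker T v -> Tdag (T x + v) = x.
Proof.
have TD := self_adjoint_decomposable norm_dot sadjT.
move=> Cx; rewrite -(orthocompl_range sadjT) => Rv.
exact: (moore_penroseE TD (moore_penroseP TD)).
Qed.

Lemma moore_penrose_domP y : op_dom Tdag y <->
  exists x v, [/\ op_carrier dot T x, op_ker T v & y = T x + v].
Proof.
have TD := self_adjoint_decomposable norm_dot sadjT.
have [-> _ _] := moore_penroseP TD.
rewrite -(orthocompl_range sadjT); split.
  move=> [_ [v [/(op_range_carrier TD)[x Cx <-] Rv ->]]].
  by exists x, v.
move=> [x [v [Cx Rv ->]]]; exists (T x), v; split => //.
by exists x => //; case: Cx.
Qed.

Lemma moore_penrose_total y : closed (op_range T) -> op_dom Tdag y.
Proof.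
move=> cR; apply/moore_penrose_domP.
have TD := self_adjoint_decomposable norm_dot sadjT.
have [p /cR/(op_range_carrier TD)[x Cx <-]] :=
  projection norm_dot y (subspace_range T).
by rewrite (orthocompl_range sadjT) => yx; exists x, (y - T x); rewrite subrKC.
Qed.

Lemma moore_penrose_ker k : op_ker T k -> Tdag k = 0.
Proof.
move=> Kk; have := @moore_penrose_decomp 0 k _ Kk; rewrite (op0 T) add0r; apply.
by split; [exact: op_dom0|exact: orthocompl0].
Qed.

Lemma moore_penrose_carrierK x : op_carrier dot T x -> Tdag (T x) = x.
Proof.
move=> Cx; have := moore_penrose_decomp Cx (subspace_ker T).1.
by rewrite addr0.
Qed.

(** In [<u, T u' + v'>] the kernel part [v'] is invisible to [u], which is in the
    carrier, so the symmetry of [T] is all that remains. *)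
Lemma moore_penrose_sym y z : op_dom Tdag y -> op_dom Tdag z ->
  dot (Tdag y) z = dot y (Tdag z).
Proof.
move=> /moore_penrose_domP[u [v [Cu Kv ->]]] /moore_penrose_domP[u' [v' [Cu' Kv' ->]]].
rewrite !moore_penrose_decomp// linearDl linearDr /= (Cu.2 _ Kv') addr0.
by rewrite [dot v u']dotC (Cu'.2 _ Kv) rmorph0 addr0 (self_adjoint_sym sadjT Cu.1 Cu'.1).
Qed.

End MoorePenrose.

Section OperatorNorm.
Context {R : realType} {X : normedModType R[i]}.
Variable S : linop X.

Lemma nrm_le_of_opnorm (c : R) (y : X) : (forall z, op_dom S z) ->
  (opnorm S <= c%:E)%E -> nrm (S y) <= c * nrm y.
Proof.
move=> S_total Sc; have [->|y0] := eqVneq y 0; first by rewrite (op0 S) !nrm0 mulr0.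
have ny := nrm_gt0 y0.
rewrite -ler_pdivrMr// mulrC; set a := (((nrm y)^-1)%:C)%C : R[i].
have na : nrm a = (nrm y)^-1 by rewrite nrm_real ger0_norm// invr_ge0 ltW.
have Sa : S (a *: y) = a *: S y.
  by rewrite -[a *: y]addr0 op_lin ?(op0 S) ?addr0//; exact: op_dom0.
rewrite -na -nrmZ -Sa -lee_fin; apply: le_trans Sc.
apply: ereal_sup_ubound; exists (a *: y) => //; split => //.
by rewrite nrmE nrmZ na mulVf ?gt_eqF// lexx.
Qed.

Lemma opnorm_le_of_nrm (c : R) :
  (forall y, nrm y <= 1 -> nrm (S y) <= c) -> (opnorm S <= c%:E)%E.
Proof.
move=> Sc; apply: ge_ereal_sup => _ [y [_ y1] <-]; rewrite lee_fin.
by apply: Sc; rewrite -lecR -nrmE.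
Qed.

End OperatorNorm.

(** * Uniform boundedness *)

Section UniformBoundedness.
Context {R : realType} {X : completeNormedModType R[i]}.
Variable dot : {dot X for @Num.conj R[i]}.
Hypothesis norm_dot : forall x : X, `|x| ^+ 2 = dot x x.

(** Of the two points [y + s] and [y - s] with [s] of length [r] along [w], one
    will do: the values of [<w, _>] at these points differ by [2 r |w|]. *)
Lemma dot_step (w y : X) (r : R) : 0 <= r ->
  exists z, nrm (z - y) <= r /\ r * nrm w <= nrm (dot w z).
Proof.
move=> r0; have [->|w0] := eqVneq w 0.
  by exists y; rewrite subrr !nrm0 mulr0 nrm_ge0.
have nw := nrm_gt0 w0.
pose s : X := ((r / nrm w)%:C)%C *: w.
have ns : nrm s = r.
  by rewrite nrmZ nrm_real ger0_norm ?divr_ge0 ?nrm_ge0// divfK ?gt_eqF.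
have ws : nrm (dot w s) = r * nrm w.
  rewrite nrm_dotC linearZl_LR nrmM nrm_real ger0_norm ?divr_ge0 ?nrm_ge0//.
  by rewrite nrm_dotxx// expr2 mulrA divfK ?gt_eqF.
have [le|lt] := leP (r * nrm w) (nrm (dot w (y + s))).
  by exists (y + s); rewrite addrC addKr ns.
exists (y - s); split; first by rewrite addrC addKr nrmN ns.
have : 2 * (r * nrm w) <= nrm (dot w (y + s)) + nrm (dot w (y - s)).
  rewrite -ws mulrDl mul1r (le_trans _ (nrmB _ _))// -linearBr /=.
  rewrite opprB [y + s]addrC -addrA [y + _]addrC subrK linearDr /=.
  by rewrite -[dot w s + _]mulr2n nrmMn mulr2n.
by lra.
Qed.

(** A gliding hump. If [W] contains [w n] of norm much larger than [3 ^ n], steps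
    of length [3 ^- n] produce [y n.+1] with [<w n, y n.+1>] at least
    [3 ^- n |w n|]. All later steps together have length at most half of
    [3 ^- n], so they leave half of this value, and the limit of [y] violates
    weak boundedness. *)
Lemma weakly_bounded_bounded (W : set X) :
  (forall y, exists M : R, forall w, W w -> nrm (dot w y) <= M) ->
  exists M : R, forall w, W w -> nrm w <= M.
Proof.
move=> Wb; apply: contrapT => /forallNP Wunb.
pose t : R := 3^-1.
have t0 n : 0 < t ^+ n by rewrite exprn_gt0// invr_gt0.
have large n : exists w, W w /\ n%:R * 2 / t ^+ n < nrm w.
  have /existsNP[w /not_implyP[Ww /negP]] := Wunb (n%:R * 2 / t ^+ n).
  by rewrite -ltNge; exists w.
have [w wP] := choice large.
have [z zP] := choice (fun p : nat * X => dot_step (w p.1) p.2 (ltW (t0 p.1))).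
pose y := fix y n := if n is m.+1 then z (m, y m) else 0.
have yS n : nrm (y n.+1 - y n) <= t ^+ n by have [] := zP (n, y n).
have wy n : t ^+ n * nrm (w n) <= nrm (dot (w n) (y n.+1)).
  by have [] := zP (n, y n).
(* The steps from [n] on sum up to a geometric tail with ratio [1 / 3]. *)
have ycauchy n k : nrm (y n - y (n + k)%N) <= t ^+ n * (3 / 2) * (1 - t ^+ k).
  elim: k => [|k IH]; first by rewrite addn0 subrr nrm0 expr0 subrr mulr0.
  rewrite (le_trans (nrm_distD (y (n + k)%N) _ _))//.
  have yk := yS (n + k)%N; rewrite nrm_distC exprD in yk; rewrite addnS exprS.
  by move: (t ^+ n) (t ^+ k) IH yk => a b; rewrite /t; lra.
have tcvg : t ^+ n * (3 / 2) @[n --> \oo] --> (0 : R).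
  rewrite -[X in _ --> X](mul0r (3 / 2)); apply: cvgM; last exact: cvg_cst.
  by apply: cvg_expr; rewrite ger0_norm ?invr_ge0// invf_lt1// ltr1n.
have [|l ly] := cauchy_nrm tcvg (u := y).
  move=> n m nm; rewrite -(subnKC nm) (le_trans (ycauchy _ _))//.
  by rewrite ler_piMr ?mulr_ge0 ?(ltW (t0 _))// gerBl ltW.
have [M lM] := Wb l.
have lower n : n%:R <= nrm (dot (w n) l).
  have [Ww nw] := wP n; have nt := t0 n; move: nw; rewrite ltr_pdivrMr// => nw.
  have := ly n.+1; rewrite exprS => lyn.
  have := cauchy_schwarz norm_dot (w n) (l - y n.+1).
  have := ler_wpM2l (nrm_ge0 (w n)) lyn.
  have := nrmB (dot (w n) l) (dot (w n) (l - y n.+1)).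
  rewrite -linearBr /= opprB addrC subrK; have := wy n.
  by move: (t ^+ n) nw => a; rewrite /t; lra.
have [n nM] : exists n, M < n%:R.
  by exists (Num.truncn M).+1; rewrite truncnS_gt.
have := le_trans (lower n) (lM _ (wP n).1).
by rewrite leNgt nM.
Qed.

End UniformBoundedness.

(** * Limits of self-adjoint operators *)

Section ResolventLimit.
Context {R : realType} {X : completeNormedModType R[i]}.
Variable dot : {dot X for @Num.conj R[i]}.
Hypothesis norm_dot : forall x : X, `|x| ^+ 2 = dot x x.
Variables (A : linop X) (A_ : nat -> linop X).
Hypothesis sadjA : self_adjoint dot A.
Hypothesis sadjA_ : forall n, self_adjoint dot (A_ n).
Hypothesis cvg_resolvent_i : forall x : X,
  resolvent 'i%C (A_ n) x @[n --> \oo] --> resolvent 'i%C A x.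

(** Take the resolvents of [A_n] at the vector [(i - A) x], which the resolvent
    of [A] sends to [x]. *)
Lemma graph_approx x : op_dom A x -> exists u : nat -> X,
  [/\ forall n, op_dom (A_ n) (u n),
      nrm (x - u n) @[n --> \oo] --> (0 : R)
    & nrm (A x - A_ n (u n)) @[n --> \oo] --> (0 : R)].
Proof.
move=> Ax; pose y := 'i%C *: x - A x.
have cvg_u : nrm (x - resolvent 'i%C (A_ n) y) @[n --> \oo] --> (0 : R).
  apply/cvg_nrmP.
  by rewrite -[X in _ --> X](resolvent_iK norm_dot sadjA Ax).
exists (fun n => resolvent 'i%C (A_ n) y).
have resP n := resolvent_iP norm_dot (sadjA_ n) y.
split=> [n|//|]; first exact: (resP n).1.
rewrite (_ : (fun n => _) = fun n => nrm (x - resolvent 'i%C (A_ n) y))//.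
apply/funext => n; have [_] := resP n; set r := resolvent _ _ _ => rE.
have -> : A x - A_ n r = 'i%C *: (x - r).
  have -> : A_ n r = 'i%C *: r - y by rewrite -rE subKr.
  by rewrite opprB /y scalerBr addrA [A x + _]addrC subrK.
by rewrite nrmZ nrm_i mul1r.
Qed.

(** [k n] is orthogonal to the range of [A_ n]. As [x] is near some [A z], which
    is near [A_ n (w n)], the inner product of [k n] with [x], and so the one
    with [u n], is a small multiple of [|k n|]. But the latter is [|k n|^2], so
    dividing by [|k n|] shows that [|k n|] itself is small. *)
Lemma ker_component_cvg0 x (u k : nat -> X) :
  orthocompl dot (op_ker A) x -> nrm (x - u n) @[n --> \oo] --> (0 : R) ->
  (forall n, op_ker (A_ n) (k n)) ->
  (forall n, orthocompl dot (op_ker (A_ n)) (u n - k n)) ->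
  nrm (k n) @[n --> \oo] --> (0 : R).
Proof.
move=> xK ux Kk uk; apply/cvgrPdist_lt => e e0.
have e3 : 0 < e / 3 by rewrite divr_gt0.
have /closure_nrmP/(_ _ e3)[_ [z Az <-] xz] := orthocompl_ker norm_dot sadjA xK.
have [w [Aw _ wz]] := graph_approx Az.
have /cvgrPdist_lt/(_ _ e3) near_u := ux.
have /cvgrPdist_lt/(_ _ e3) near_w := wz.
near=> n; rewrite sub0r normrN ger0_norm ?nrm_ge0//.
have un : nrm (x - u n) < e / 3.
  rewrite (le_lt_trans (ler_norm _))// -normrN -sub0r.
  by near: n.
have wn : nrm (A z - A_ n (w n)) < e / 3.
  rewrite (le_lt_trans (ler_norm _))// -normrN -sub0r.
  by near: n.
have kw : dot (k n) (A_ n (w n)) = 0.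
  have [Ak k0] := Kk n.
  by rewrite -(self_adjoint_sym (sadjA_ n) Ak (Aw n)) k0 linear0l.
have kuk : dot (k n) (u n - k n) = 0 by rewrite dotC (uk n _ (Kk n)) rmorph0.
(* Subtracting [A_ n (w n)] from [u n] leaves the product with [k n] unchanged,
   and the difference splits into three small terms. *)
have kE : dot (k n) (k n) =
    dot (k n) (x - A z + (A z - A_ n (w n)) - (x - u n)).
  have -> : x - A z + (A z - A_ n (w n)) - (x - u n) =
      (u n - k n) + k n - A_ n (w n).
    by rewrite subrK addrA subrK opprB [x - _ + _]addrC addrA subrK.
  by rewrite linearBr linearDr /= kw kuk add0r subr0.
have : nrm (k n) ^+ 2 <=
    nrm (k n) * nrm (x - A z + (A z - A_ n (w n)) - (x - u n)).
  by rewrite -(nrm_dotxx norm_dot) kE cauchy_schwarz.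
have [-> //|k0] := eqVneq (nrm (k n)) 0.
rewrite expr2 ler_pM2l; last by rewrite lt_neqAle eq_sym k0 nrm_ge0.
move=> /le_lt_trans; apply; rewrite (le_lt_trans (nrmB _ _))//.
have := nrmD (x - A z) (A z - A_ n (w n)).
by lra.
Unshelve. all: by end_near. Qed.

Lemma carrier_approx x : op_carrier dot A x -> exists c : nat -> X,
  [/\ forall n, op_carrier dot (A_ n) (c n),
      nrm (x - c n) @[n --> \oo] --> (0 : R)
    & nrm (A x - A_ n (c n)) @[n --> \oo] --> (0 : R)].
Proof.
move=> [Ax xK]; have [u [Au ux Aux]] := graph_approx Ax.
have dec n : exists k, op_ker (A_ n) k /\ op_carrier dot (A_ n) (u n - k).
  have [k [c [Kk Cc ->]]] :=
    self_adjoint_decomposable norm_dot (sadjA_ n) (Au n).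
  by exists k; rewrite addrC addKr.
have [k kP] := choice dec.
have k_cvg : nrm (k n) @[n --> \oo] --> (0 : R).
  by apply: (ker_component_cvg0 xK ux) => n; have [Kk [_ ?]] := kP n.
exists (fun n => u n - k n); split=> [n||]; first exact: (kP n).2.
  apply: (@squeeze_cvgr _ _ _ _ (fun=> 0) (fun n => nrm (x - u n) + nrm (k n))).
  - by apply: nearW => n; rewrite nrm_ge0 opprD opprK addrA nrmD.
  - exact: cvg_cst.
  - by rewrite -[X in _ --> X](addr0 0); exact: cvgD.
rewrite (_ : (fun n => _) = fun n => nrm (A x - A_ n (u n)))//.
apply/funext => n; have [[Ak k0] _] := kP n.
by have [_ ->] := op_sub (Au n) Ak; rewrite k0 subr0.
Qed.

Section LowerBound.
Variable c : R.
Hypothesis c0 : 0 <= c.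
Hypothesis carrier_bound_ :
  forall n x, op_carrier dot (A_ n) x -> nrm x <= c * nrm (A_ n x).

Lemma carrier_bound x : op_carrier dot A x -> nrm x <= c * nrm (A x).
Proof.
move=> /carrier_approx[u [Cu ux Aux]].
have lim_bound : nrm (x - u n) + c * (nrm (A x) + nrm (A x - A_ n (u n)))
    @[n --> \oo] --> c * nrm (A x).
  rewrite -[X in _ --> X]add0r; apply: cvgD => //.
  rewrite -{2}[nrm (A x)]addr0; apply: cvgM; first exact: cvg_cst.
  by apply: cvgD => //; exact: cvg_cst.
apply: (ler_cvg_to (cvg_cst _) lim_bound).
apply: nearW => n; have := carrier_bound_ (Cu n).
have := nrmD (x - u n) (u n); rewrite subrK => le1 le2.
have := nrmB (A x) (A x - A_ n (u n)); rewrite subKr => le3.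
by have := ler_wpM2l c0 le3; lra.
Qed.

Lemma closed_range_limit : closed (op_range A).
Proof.
have decA := self_adjoint_decomposable norm_dot sadjA.
have -> : op_range A = A @` op_carrier dot A.
  apply/seteqP; split=> [y /(op_range_carrier decA)[x Cx <-]|_ [x [Ax _] <-]].
    by exists x.
  by exists x.
apply: (@closure_image_bounded_below _ _ _ _ _ c).
  move=> u v [Au Ku] [Av Kv]; have [Auv <-] := op_sub Au Av.
  apply: carrier_bound; split => //.
  by rewrite addrC -scaleN1r; exact: orthocompl_lin.
move=> x y xy; have [Ax <-] : op_dom A x /\ A x = y.
  apply: (self_adjoint_closed norm_dot sadjA) => e /xy[u [[Au _] xu yu]].
  by exists u.
by have [z Cz <-] := op_range_carrier decA (ex_intro2 _ _ x Ax erefl); exists z.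
Qed.

(** For [y = A x + v], the part [A x] is compared with [A_ n (u n)], where
    [A_n^dag] returns [u n], and [v] with [w n]. On the kernel part of [w n]
    [A_n^dag] vanishes, while the carrier part has norm at most [c |A_ n (w n)|],
    which tends to [c |A v| = 0]. *)
Lemma moore_penrose_cvg y : (forall n, closed (op_range (A_ n))) ->
  (forall n z, nrm (moore_penrose dot (A_ n) z) <= c * nrm z) ->
  moore_penrose dot (A_ n) y @[n --> \oo] --> moore_penrose dot A y.
Proof.
move=> cR mp_bound; pose P n := moore_penrose dot (A_ n).
have P_total n z : op_dom (P n) z by exact: moore_penrose_total.
have /(moore_penrose_domP norm_dot sadjA)[x [v [Cx Kv ->]]] :
  op_dom (moore_penrose dot A) y by exact: moore_penrose_total closed_range_limit.
rewrite moore_penrose_decomp//; apply/cvg_nrmP.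
have [u [Cu ux Aux]] := carrier_approx Cx.
have [Av v0] := Kv; have [w [Aw wv Awv]] := graph_approx Av.
rewrite v0 in Awv.
have Pw n : nrm (P n (w n)) <= c ^+ 2 * nrm (0 - A_ n (w n)).
  have [k [d [Kk Cd wE]]] :=
    self_adjoint_decomposable norm_dot (sadjA_ n) (Aw n).
  have Awd : A_ n (w n) = A_ n d.
    by rewrite wE; have [_ ->] := op_add Kk.1 Cd.1; rewrite Kk.2 add0r.
  rewrite wE; have [_ ->] := op_add (P_total n k) (P_total n d).
  rewrite /P moore_penrose_ker// add0r -wE Awd sub0r nrmN.
  rewrite (le_trans (mp_bound _ _))// expr2 -mulrA ler_wpM2l//.
  exact: carrier_bound_.
(* The four errors: from [u n], from [A_ n (u n)], from [w n], and [Pw]. *)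
pose b n := nrm (x - u n) + c * nrm (A x - A_ n (u n)) +
            (c * nrm (v - w n) + c ^+ 2 * nrm (0 - A_ n (w n))).
apply: (@squeeze_cvgr _ _ _ _ (fun=> 0) b); last first.
- have scale a (s : nat -> R) : s n @[n --> \oo] --> (0 : R) ->
      a * s n @[n --> \oo] --> (0 : R).
    by move=> s0; rewrite -[X in _ --> X](mulr0 a); apply: cvgM => //; exact: cvg_cst.
  rewrite -[X in _ --> X](addr0 0); apply: cvgD; rewrite -[X in _ --> X](addr0 0);
    apply: cvgD => //; exact: scale.
- exact: cvg_cst.
apply: nearW => n; rewrite nrm_ge0 /=.
have PE : P n (A x + v) = u n + P n (A x - A_ n (u n)) + (P n (v - w n) + P n (w n)).
  have [_ <-] := op_add (P_total n (v - w n)) (P_total n (w n)); rewrite subrK.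
  rewrite -{1}(moore_penrose_carrierK norm_dot (sadjA_ n) (Cu n)).
  have [_ <-] := op_add (P_total n (A_ n (u n))) (P_total n (A x - A_ n (u n))).
  rewrite [A_ n (u n) + _]addrC subrK.
  by have [_ ->] := op_add (P_total n (A x)) (P_total n v).
have -> : x - moore_penrose dot (A_ n) (A x + v) =
    x - u n - P n (A x - A_ n (u n)) - (P n (v - w n) + P n (w n)).
  by rewrite -/(P n) PE !opprD !addrA.
rewrite (le_trans (nrmB _ _))// lerD//.
  by rewrite (le_trans (nrmB _ _))// lerD//; exact: mp_bound.
by rewrite (le_trans (nrmD _ _))// lerD//; exact: mp_bound.
Qed.

End LowerBound.

End ResolventLimit.

(** * Finite suprema and the equivalence *)

Lemma ereal_sup_ltyP (R : realType) (S : set (\bar R)) :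
  (ereal_sup S < +oo)%E <->
  exists2 c : R, 0 <= c & forall s, S s -> (s <= c%:E)%E.
Proof.
split=> [|[c _ Sc]].
  case E : (ereal_sup S) => [r| |] // _.
    exists (Num.max 0 r); first by rewrite le_max lexx.
    move=> s Ss; apply: (@le_trans _ _ r%:E).
      by rewrite -E; exact: ereal_sup_ubound.
    by rewrite lee_fin le_max lexx orbT.
  exists 0 => // s Ss; apply: (@le_trans _ _ (ereal_sup S)).
    exact: ereal_sup_ubound.
  by rewrite E leNye.
by apply: (@le_lt_trans _ _ c%:E); [exact: ge_ereal_sup|exact: ltry].
Qed.

Theorem theorem1p2 (R : realType) (X : completeNormedModType R[i])
    (dot : {dot X for @Num.conj R[i]})
    (norm_dot : forall x : X, `|x| ^+ 2 = dot x x)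
    (A : linop X) (A_ : nat -> linop X)
    (sadjA : self_adjoint dot A)
    (sadjA_ : forall n, self_adjoint dot (A_ n))
    (closed_range : forall n, closed (op_range (A_ n)))
    (cvg_resolvent : forall l : R[i], l \isn't Num.real ->
       forall x : X, resolvent l (A_ n) x @[n --> \oo] --> resolvent l A x) :
  ((ereal_sup [set opnorm (moore_penrose dot (A_ n)) | n in [set: nat]]
      < +oo)%E ->
    closed (op_range A))
  /\
  ((op_dom (moore_penrose dot A) = [set: X] /\
    forall y : X, moore_penrose dot (A_ n) y @[n --> \oo]
                    --> moore_penrose dot A y)
   <->
   (ereal_sup [set opnorm (moore_penrose dot (A_ n)) | n in [set: nat]]
      < +oo)%E).
Proof.
have cvg_i x : resolvent 'i%C (A_ n) x @[n --> \oo] --> resolvent 'i%C A x.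
  apply: cvg_resolvent; rewrite complexiE; apply/negP => /Creal_ImP.
  by rewrite Im_i => /eqP; rewrite oner_eq0.
pose P n := moore_penrose dot (A_ n).
have P_total n z : op_dom (P n) z by exact: moore_penrose_total.
have bounded : (ereal_sup [set opnorm (P n) | n in [set: nat]] < +oo)%E ->
    exists2 c : R, 0 <= c & forall n z, nrm (P n z) <= c * nrm z.
  move=> /ereal_sup_ltyP[c c0 Pc]; exists c => // n z.
  by apply: nrm_le_of_opnorm => //; apply: Pc; exists n.
have carrier_bound_ c : (forall n z, nrm (P n z) <= c * nrm z) ->
    forall n x, op_carrier dot (A_ n) x -> nrm x <= c * nrm (A_ n x).
  move=> Pc n x Cx; rewrite -{1}(moore_penrose_carrierK norm_dot (sadjA_ n) Cx).
  exact: Pc.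
have closedA : (ereal_sup [set opnorm (P n) | n in [set: nat]] < +oo)%E ->
    closed (op_range A).
  move=> /bounded[c c0 Pc].
  exact: (closed_range_limit norm_dot sadjA sadjA_ cvg_i c0 (carrier_bound_ c Pc)).
split=> //; split=> [[_ Pcvg]|Pfin]; last first.
  split.
    by apply/seteqP; split=> // y _; apply: moore_penrose_total => //; exact: closedA.
  have [c c0 Pc] := bounded Pfin.
  move=> y.
  exact: (moore_penrose_cvg norm_dot sadjA sadjA_ cvg_i c0 (carrier_bound_ c Pc)).
(* By symmetry [<P n x, y> = <x, P n y>], and [P n y] is a convergent sequence. *)
have [|M WM] := @weakly_bounded_bounded _ _ dot norm_dot
    [set z | exists n x, nrm x <= 1 /\ z = P n x].
  move=> y; have /cvg_nrmP Py := Pcvg y.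
  have [M [_ HM]] := cvg_seq_bounded (cvgP _ Py).
  exists (nrm (moore_penrose dot A y) + (`|M| + 1)) => _ [n [x [x1 ->]]].
  rewrite (moore_penrose_sym norm_dot (sadjA_ n) (P_total n x) (P_total n y)).
  rewrite (le_trans (cauchy_schwarz norm_dot _ _))//.
  rewrite (le_trans (ler_wpM2r (nrm_ge0 _) x1))// mul1r.
  have Mn : `|nrm (moore_penrose dot A y - P n y)| <= `|M| + 1.
    by apply: (HM (`|M| + 1)) => //; rewrite ltr_pwDr// ler_norm.
  have := nrmB (moore_penrose dot A y) (moore_penrose dot A y - P n y).
  rewrite subKr => /le_trans; apply; rewrite lerD2l.
  exact: le_trans (ler_norm _) Mn.
apply/ereal_sup_ltyP; exists `|M| => // _ [n _ <-].
apply: opnorm_le_of_nrm => x x1; rewrite (le_trans _ (ler_norm M))//.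
by apply: WM; exists n, x.
Qed.
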